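(* Let $F$ be a field, $n\ge 1$, and let $a = (a_{ij})$ and $a'$ be in $M_n(F)$. Then the following are true: 1. $a$ is invertible if and only if $c_n(a)\neq 0$. 2. (Jacobi formula) $c_n(a) = \sum_{\sigma\in S_n} (\operatorname{sign}\sigma)\, a_{1\sigma(1)}a_{2\sigma(2)}\cdots a_{n\sigma(n)}$. 3. $c_n(aa') = c_n(a)\,c_n(a')$.
   Context: Here $c_n$ is defined as follows, for the $F$-algebra $A = M_n(F)$ (and NOT by the usual determinant formula). For a finite-dimensional associative unital $F$-algebra $A$, let $a_1,\dots,a_m$ be an $F$-basis of $A$, $R = F[t_1,\dots,t_m]$ a polynomial ring in commuting indeterminates, $K$ the fraction field of $R$, and $\gamma = \sum_i t_i a_i \in A\otimes_F K$ (the generic element). Let $\mathrm{min.poly.}_{\gamma/K} \in K[x]$ be the monic polynomial of least degree satisfied by $\gamma$; it is a fact that its coefficients lie in $R$. For $a = \sum_i \alpha_i a_i \in A$ with $\alpha_i\in F$, the characteristic polynomial $\mathrm{ch.poly.}_{a,A/F}\in F[x]$ is the image of $\mathrm{min.poly.}_{\gamma/K}$ under the substitution $t_i\mapsto \alpha_i$; it does not depend on the choice of basis. For $A = M_n(F)$ this polynomial is monic of degree $n$ for every $a$, and one writes $$\mathrm{ch.poly.}_a(x) = x^n - c_1(a)x^{n-1} + \cdots + (-1)^{n-1}c_{n-1}(a)x + (-1)^n c_n(a).$$ *)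

(* Defs.v *)
From Stdlib Require Import ClassicalEpsilon.
From mathcomp Require Import all_boot all_order all_algebra all_fingroup.
From mathcomp Require Import mpoly.

Set Implicit Arguments.
Unset Strict Implicit.
Unset Printing Implicit Defensive.

Import GRing.Theory.
Local Open Scope ring_scope.

Section GenericCharacteristicPolynomial.

Variables (F : fieldType) (n m : nat).
Implicit Types (e : m.-tuple 'M[F]_n.+1) (a : 'M[F]_n.+1).

Let R := {mpoly F[m]}.
Let K := {fraction R}.

(* The generic element, with M_n(F) (x)_F K identified with M_n(K).           *)
Definition generic_elt e : 'M[K]_n.+1 :=
  \sum_(i < m)
    tofrac ('X_i : R) *: map_mx (fun c : F => tofrac (c%:MP : R)) (tnth e i).

(* The minimal polynomial of the generic element over K, seen in R[x]. When e *)
(* is a basis its coefficients do lie in R, and the P below is then unique    *)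
(* because R embeds in K; otherwise the value is unspecified.                 *)
Definition generic_minpoly e : {poly R} :=
  epsilon (inhabits 0)
    (fun P : {poly R} =>
       map_poly (@tofrac R) P = mxminpoly (generic_elt e)).

(* The image of generic_minpoly e under t_i |-> alpha_i, where alpha_i is the *)
(* i-th coordinate of a in the basis e.                                       *)
Definition chpoly e a : {poly F} :=
  map_poly (meval (fun i => coord e i a)) (generic_minpoly e).

(* c_k(a), from ch.poly._a = \sum_k (-1)^k c_k(a) x^(N - k) with N = n.+1 the *)
(* size of the matrices.                                                      *)
Definition chcoef e (k : nat) a : F :=
  (-1) ^+ k * (chpoly e a)`_(n.+1 - k).

End GenericCharacteristicPolynomial.

(* Main.v *)
(** The generic matrix specializes to every matrix over [F], in particular to
    the nilpotent shift, for which the first basis vector is cyclic. Cyclicity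
    of a vector is the nonvanishing of a determinant (of the rows [v A^i]), so
    it lifts to the generic matrix. A matrix with a cyclic vector has its
    characteristic polynomial as minimal polynomial; hence [chpoly e a] is the
    usual [char_poly a] and [c_n(a)] is the usual determinant. *)

Require Import Defs.
From Stdlib Require Import ClassicalEpsilon.
From mathcomp Require Import all_boot all_order all_algebra all_fingroup.
From mathcomp Require Import mpoly.

Set Implicit Arguments.
Unset Strict Implicit.
Unset Printing Implicit Defensive.

Import GRing.Theory.
Local Open Scope ring_scope.

Definition krylov (R : nzRingType) (n : nat) (v : 'rV[R]_n.+1)
    (A : 'M[R]_n.+1) : 'M[R]_n.+1 :=
  \matrix_i (v *m A ^+ i).

Lemma map_krylov (R S : nzRingType) (f : {rmorphism R -> S}) (n : nat)
    (v : 'rV[R]_n.+1) (A : 'M[R]_n.+1) :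
  map_mx f (krylov v A) = krylov (map_mx f v) (map_mx f A).
Proof. by apply/row_matrixP=> i; rewrite -map_row !rowK map_mxM rmorphXn. Qed.

(** Linear relations among the rows [v *m A ^+ i] thus correspond to polynomials of degree at most
    [n] in [A] that kill [v]. *)
Lemma mul_krylov (R : comNzRingType) (n : nat) (u v : 'rV[R]_n.+1)
    (A : 'M[R]_n.+1) :
  u *m krylov v A = v *m horner_mx A (rVpoly u).
Proof.
rewrite mulmx_sum_row [rVpoly u]poly_def !linear_sum; apply: eq_bigr => i _.
by rewrite valK rowK !linearZ rmorphXn /= horner_mx_X.
Qed.

Lemma mxminpoly_cyclic (K : fieldType) (n : nat) (v : 'rV[K]_n.+1)
    (A : 'M[K]_n.+1) :
  row_free (krylov v A) -> mxminpoly A = char_poly A.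
Proof.
move=> free_vA; apply/eqP.
rewrite -eqp_monic ?mxminpoly_monic ?char_poly_monic //.
rewrite -(dvdp_size_eqp (mxminpoly_dvd_char A)) size_char_poly eqn_leq.
rewrite -{1}(size_char_poly A) dvdp_leq ?mxminpoly_dvd_char //=; last first.
  exact/monic_neq0/char_poly_monic.
(* If the degree were at most [n], the coefficients would fit in a row vector and give a relation
   among the free Krylov rows, forcing the polynomial to vanish. *)
rewrite ltnNge; apply: contra_neqN (monic_neq0 (mxminpoly_monic A)) => le_p_n.
rewrite -(poly_rV_K le_p_n).
suff ->: poly_rV (mxminpoly A) = 0 :> 'rV_n.+1 by rewrite linear0.
apply: (row_free_inj free_vA).
by rewrite mul_krylov poly_rV_K // mx_root_minpoly mulmx0 mul0mx.
Qed.

Definition shift_mx (R : nzRingType) (n : nat) : 'M[R]_n.+1 :=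
  \matrix_(i, j) (j == i.+1 :> nat)%:R.

Lemma krylov_shift (R : nzRingType) (n : nat) :
  krylov (delta_mx 0 0) (shift_mx R n) = 1%:M.
Proof.
apply/row_matrixP=> -[i lt_i]; rewrite rowK row1 /=.
elim: i lt_i => [|i IH] lt_i.
  by rewrite expr0 mulmx1; congr delta_mx; apply/val_inj.
rewrite exprSr mulmxA (IH (ltnW lt_i)) -rowE.
by apply/rowP=> j; rewrite !mxE eqxx.
Qed.

Section GenericMatrix.

Variables (F : fieldType) (n m : nat) (e : m.-tuple 'M[F]_n.+1).
Hypothesis e_basis : basis_of fullv e.

Let R := {mpoly F[m]}.

(** Keeping the entries in [R] allows both embedding into [K] and evaluation in [F]. *)
Definition generic_mx : 'M[R]_n.+1 :=
  \sum_(i < m) 'X_i *: map_mx (@mpolyC m F) (tnth e i).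

Lemma map_tofrac_generic_mx :
  map_mx (@tofrac R) generic_mx = generic_elt e.
Proof.
rewrite /generic_mx raddf_sum /=; apply: eq_bigr => i _.
by rewrite map_mxZ -map_mx_comp.
Qed.

Lemma meval_generic_mx (a : 'M[F]_n.+1) :
  map_mx (meval (fun i => coord e i a)) generic_mx = a.
Proof.
rewrite [RHS](coord_basis e_basis (memvf a)) /generic_mx raddf_sum /=.
apply: eq_bigr => i _; rewrite map_mxZ /= mevalXU -tnth_nth; congr (_ *: _).
by apply/matrixP=> j k; rewrite !mxE mevalC.
Qed.

Lemma mxminpoly_generic_elt :
  mxminpoly (generic_elt e) = char_poly (generic_elt e).
Proof.
apply: (@mxminpoly_cyclic _ _ (delta_mx 0 0)).
rewrite row_free_unit unitmxE unitfE.
rewrite -map_tofrac_generic_mx -(map_delta_mx (@tofrac R)) -map_krylov.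
rewrite det_map_mx tofrac_eq0; apply/eqP=> det0.
(* At the coordinates of the shift, the Krylov determinant takes the value 1. *)
have/eqP := congr1 (meval (fun i => coord e i (shift_mx F n))) det0.
rewrite -det_map_mx map_krylov meval_generic_mx map_delta_mx krylov_shift.
by rewrite det1 rmorph0 oner_eq0.
Qed.

(** The right-hand side witnesses the [epsilon] predicate; injectivity of [tofrac] leaves no other
    choice. *)
Lemma generic_minpolyE : generic_minpoly e = char_poly generic_mx.
Proof.
have tofrac_inj: injective (@tofrac R).
  by move=> p q /eqP; rewrite tofrac_eq => /eqP.
apply: (map_inj_poly tofrac_inj (tofrac0 R)).
rewrite map_char_poly map_tofrac_generic_mx -mxminpoly_generic_elt.
rewrite /generic_minpoly; apply: (epsilon_spec (inhabits _)
  (fun P : {poly R} => map_poly _ P = mxminpoly (generic_elt e))).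
exists (char_poly generic_mx).
by rewrite map_char_poly map_tofrac_generic_mx mxminpoly_generic_elt.
Qed.

Lemma chpolyE (a : 'M[F]_n.+1) : chpoly e a = char_poly a.
Proof.
by rewrite /chpoly generic_minpolyE map_char_poly meval_generic_mx.
Qed.

(** The constant coefficient of [char_poly a] is [(-1) ^+ n.+1 * \det a], and the two signs
    cancel. *)
Lemma chcoef_det (a : 'M[F]_n.+1) : chcoef e n.+1 a = \det a.
Proof. by rewrite /chcoef subnn chpolyE char_poly_det signrMK. Qed.

End GenericMatrix.

Theorem proposition2p6 (F : fieldType) (n m : nat)
    (e : m.-tuple 'M[F]_n.+1) (e_basis : basis_of fullv e)
    (a a' : 'M[F]_n.+1) :
  [/\ (exists b : 'M[F]_n.+1, a *m b = 1%:M /\ b *m a = 1%:M)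
        <-> chcoef e n.+1 a <> 0,
      chcoef e n.+1 a
        = \sum_(s : 'S_n.+1) (-1) ^+ s * \prod_(i < n.+1) a i (s i)
    & chcoef e n.+1 (a *m a') = chcoef e n.+1 a * chcoef e n.+1 a'].
Proof.
(* The Jacobi formula is the definition of [\det] itself. *)
rewrite !chcoef_det //; split; [|by []|exact: det_mulmx].
rewrite (rwP eqP) (rwP negP) -unitfE -unitmxE.
split=> [[b [/mulmx1_unit[]]] //|ua].
by exists (invmx a); rewrite mulmxV ?mulVmx.
Qed.
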